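(* Let $r\ge 6$ and $n\ge 2(r-2)(r-1)+1$ be integers, and let $\mathcal{H}=\mathcal{H}(2n,r)$. Then, for positive integers $k$: (1) $\mathcal{H}$ is not $k$-NMNR colourable for $k>n$; (2) $\mathcal{H}$ is $k$-NMNR colourable for $\lceil n/(r-2)\rceil\le k\le n$; (3) $\mathcal{H}$ is not $k$-NMNR colourable for $2r-5\le k<\lceil n/(r-2)\rceil$; (4) $\mathcal{H}$ is $k$-NMNR colourable for $2\le k\le 2r-6$.
   Context: $\mathcal{H}(2n,r)$ is the $r$-uniform hypergraph with $2n$ vertices partitioned into $n$ classes of size $2$, whose edges are all the $r$-subsets of vertices that contain both vertices of exactly one class and whose other $r-2$ vertices come from $r-2$ distinct further classes (one vertex from each). (Equivalently, edges are the $r$-subsets $R$ whose non-zero intersection sizes with the classes form the partition $(1^{r-2},2)$ of $r$.) A $k$-NMNR (non-monochromatic non-rainbow) colouring of a hypergraph is a colouring of its vertices using exactly $k$ distinct colours (all $k$ are used) such that no edge has all its vertices of the same colour and no edge has all its vertices of pairwise distinct colours. A hypergraph is $k$-NMNR colourable if it has a $k$-NMNR colouring. *)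

(* Defs.v *)
From mathcomp Require Import all_boot all_order all_algebra.

Set Implicit Arguments.
Unset Strict Implicit.
Unset Printing Implicit Defensive.

(* A hypergraph on the vertex type V is given by its set of edges. *)
Definition hypergraph (V : finType) := {set {set V}}.

Section Colouring.

Variables (V : finType) (C : Type).

Definition monochromatic (c : V -> C) (e : {set V}) : Prop :=
  {in e &, forall x y, c x = c y}.

Definition rainbow (c : V -> C) (e : {set V}) : Prop :=
  {in e &, injective c}.

End Colouring.

(* The k colours are the elements of 'I_k; the first component says that all *)
(* of them are used.                                                         *)
Definition NMNR_colouring (V : finType) (H : hypergraph V) (k : nat)
    (c : V -> 'I_k) : Prop :=
  (forall a : 'I_k, exists x : V, c x = a) /\
  (forall e : {set V}, e \in H -> ~ monochromatic c e /\ ~ rainbow c e).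

Definition NMNR_colourable (V : finType) (H : hypergraph V) (k : nat) : Prop :=
  exists c : V -> 'I_k, NMNR_colouring H c.

(* The 2n vertices are the pairs (i, b); the i-th class is                   *)
(* {(i, false), (i, true)}.                                                  *)
Definition vclass (n : nat) (i : 'I_n) : {set 'I_n * bool} :=
  [set v | v.1 == i].

(* The last condition says that the r - 2 vertices of R outside the class i  *)
(* lie in r - 2 distinct classes; hence i is the only class contained in R.  *)
Definition calH (n r : nat) : hypergraph ('I_n * bool)%type :=
  [set R : {set 'I_n * bool} |
    (#|R| == r) &&
    [exists i : 'I_n,
       (vclass i \subset R) &&
       (#|[set v.1 | v in R :\: vclass i]| == r - 2)]].

(* Main.v *)
(* Put s = r - 2. An edge consists of a full class and one vertex from each of s
   other classes.
     Suppose c is an NMNR colouring, and choose one vertex of each colour. If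
   k > 2 s and some class has two colours, then the k - 2 >= 2 s - 1 chosen
   vertices of other colours meet at least s classes, and complete that class to
   a rainbow edge; so all classes are monochromatic and k <= n.
     If 2 s - 1 <= k and n > s k, some colour a is carried by more than 2 s
   vertices. No class is monochromatic of colour a, as it would extend to a
   monochromatic edge; hence k <= 2 s, and by pigeonhole two classes have the
   same pair of colours {a, b}. The chosen vertices of colours other than a, b
   cannot meet s classes, so they contain a full class; that class, a vertex of
   colour a in one of the two parallel classes, a vertex of colour b in the other
   and the remaining chosen vertices contain a rainbow edge.
     Colouring class i monochromatically by i mod k gives all n / s <= k <= n. For
   2 <= k <= 2 s - 2, colour all but at most s - 2 classes with {0, 1}, and use
   the other colours on the remaining classes: each of the s + 1 classes meeting
   an edge contributes a vertex, so three of its vertices have a colour in {0, 1}. *)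

Require Import Defs.
From mathcomp Require Import all_boot all_order all_algebra.
From mathcomp Require Import zify.

Set Implicit Arguments.
Unset Strict Implicit.
Unset Printing Implicit Defensive.

Import Order.TTheory GRing.Theory Num.Theory.

(** * Building edges and counting the classes they meet *)

Section Edges.

Variable n : nat.
Implicit Types (i : 'I_n) (v : 'I_n * bool) (W R : {set 'I_n * bool}).

Lemma mem_vclass i v : (v \in vclass i) = (v.1 == i).
Proof. by rewrite inE. Qed.

Lemma card_vclass i : #|vclass i| = 2.
Proof.
have -> : vclass i = setX [set i] [set: bool].
  by apply/setP=> -[j b]; rewrite mem_vclass !inE andbT.
by rewrite cardsX cards1 cardsT card_bool.
Qed.

Lemma card_le_classes W : #|W| <= 2 * #|[set v.1 | v in W]|.
Proof.
have sWX : W \subset setX [set v.1 | v in W] [set: bool].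
  by apply/subsetP=> -[j b] Wv; rewrite !inE andbT; apply/imsetP; exists (j, b).
by have := subset_leq_card sWX; rewrite cardsX cardsT card_bool mulnC.
Qed.

(** Pick [s] classes met by [W] and one vertex of [W] in each. With [W] rainbow or of one colour,
    this produces the forbidden edges. *)
Lemma edge_within s i W :
  i \notin [set v.1 | v in W] -> s <= #|[set v.1 | v in W]| ->
  exists2 R, R \in calH n s.+2 & vclass i \subset R /\ R \subset vclass i :|: W.
Proof.
move=> Wi /card_geqP[t [t_uniq t_size tW]].
pose I := [set j in t].
have cardI : #|I| = s by rewrite cardsE; move/card_uniqP: t_uniq => ->.
have sIW j : j \in I -> j \in [set v.1 | v in W] by rewrite inE => /tW.
pose f j := odflt (j, true) [pick v in W | v.1 == j].
have fP j : j \in I -> f j \in W /\ (f j).1 = j.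
  move=> /sIW /imsetP[v Wv jE]; rewrite /f; case: pickP => [w /andP[? /eqP]//|].
  by move=> /(_ v); rewrite Wv jE eqxx.
have fI1 : [set v.1 | v in f @: I] = I.
  rewrite -imset_comp -[RHS]imset_id; apply: eq_in_imset => j Ij /=.
  by have [] := fP j Ij.
have iI : i \notin I by apply: contra Wi => /sIW.
have dis : [disjoint vclass i & f @: I].
  rewrite -setI_eq0; apply/eqP/setP=> v; rewrite !inE; apply/negP.
  by case/andP=> /eqP vi /imsetP[j Ij vE]; move: iI; rewrite -vi vE (fP j Ij).2 Ij.
have cardfI : #|f @: I| = s.
  rewrite card_in_imset ?cardI // => j l Ij Il fE.
  by rewrite -(fP j Ij).2 -(fP l Il).2 fE.
exists (vclass i :|: f @: I); last first.
  split; first exact: subsetUl.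
  apply: setUS; apply/subsetP=> _ /imsetP[j Ij ->]; exact: (fP j Ij).1.
rewrite inE; apply/andP; split.
  by rewrite cardsU disjoint_setI0 // cards0 subn0 card_vclass cardfI.
apply/existsP; exists i; rewrite subsetUl /=.
rewrite setDUl setDv set0U (setDidPl _) 1?disjoint_sym // fI1 cardI.
by rewrite subn2.
Qed.

(** The strict bound comes from counting class [i] on top of the [s] classes of the other
    vertices. *)
Lemma edge_class s R : R \in calH n s.+2 ->
  exists2 i, vclass i \subset R & s < #|[set v.1 | v in R]|.
Proof.
rewrite inE => /andP[_ /existsP[i /andP[sR]]]; rewrite subn2 /= => /eqP cardR.
exists i => //; apply: leq_trans (_ : #|i |: [set v.1 | v in R :\: vclass i]| <= _).
  rewrite cardsU1 cardR; suff -> : i \notin [set v.1 | v in R :\: vclass i] by [].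
  by apply/imsetP=> -[v]; rewrite !inE => /andP[/eqP vi _] iE; apply: vi.
apply: subset_leq_card; rewrite subUset sub1set imsetS ?subsetDl // andbT.
by apply/imsetP; exists (i, true) => //; apply: (subsetP sR); rewrite inE.
Qed.

End Edges.

(** * Restrictions on a given colouring *)

Section NoColouring.

Variables (n s k : nat) (c : 'I_n * bool -> 'I_k).
Hypothesis cP : NMNR_colouring (calH n s.+2) c.
Implicit Types (i : 'I_n) (v : 'I_n * bool) (W : {set 'I_n * bool}).

(** Otherwise [edge_within] completes class [i] by vertices of [W] to an edge, which would be
    rainbow. *)
Lemma few_classes i W :
    c (i, false) != c (i, true) -> {in W &, injective c} ->
    (forall v, v \in W -> (c v != c (i, false)) && (c v != c (i, true))) ->
  #|[set v.1 | v in W]| < s.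
Proof.
move=> ci injW Wi; rewrite ltnNge; apply/negP=> sW.
have iW : i \notin [set v.1 | v in W].
  by apply/imsetP=> -[[j b] /Wi + /= ij]; rewrite -ij; case: b; rewrite eqxx ?andbF.
have [R RH [_ sR]] := edge_within iW sW; have [_] := cP.2 R RH; apply.
have RP v : v \in R -> v \in W \/ v = (i, false) \/ v = (i, true).
  move=> /(subsetP sR); rewrite !inE => /orP[/eqP|]; last by left.
  by case: v => j [] /= ->; right; [right | left].
move=> u v /RP Ru /RP Rv.
case: Ru => [Wu | [] ->]; case: Rv => [Wv | [] ->] // cE.
- exact: injW.
- by have := Wi u Wu; rewrite cE eqxx.
- by have := Wi u Wu; rewrite cE eqxx andbF.
- by have := Wi v Wv; rewrite -cE eqxx.
- by move: ci; rewrite cE eqxx.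
- by have := Wi v Wv; rewrite -cE eqxx andbF.
- by move: ci; rewrite cE eqxx.
Qed.

(** If colour [a] met more than [s] classes, at least [s] would remain besides [i], giving a
    monochromatic edge. *)
Lemma few_vertices_mono i (a : 'I_k) :
  c (i, false) = a -> c (i, true) = a -> #|[set v | c v == a]| <= 2 * s.
Proof.
move=> ci0 ci1; set A := [set v | c v == a].
apply: leq_trans (card_le_classes A) _; rewrite leq_pmul2l // leqNgt.
apply/negP=> sA; pose W := A :\: vclass i.
have iW : i \notin [set v.1 | v in W].
  by apply/imsetP=> -[v]; rewrite !inE => /andP[/eqP vi _] iE; apply: vi.
have sW : s <= #|[set v.1 | v in W]|.
  rewrite -ltnS; apply: leq_trans sA _.
  apply: leq_trans (_ : #|i |: [set v.1 | v in W]| <= _); last first.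
    by rewrite cardsU1; case: (_ \notin _).
  apply: subset_leq_card; apply/subsetP=> _ /imsetP[v Av ->].
  rewrite !inE; case: eqP => //= vi; apply/imsetP; exists v => //.
  by rewrite in_setD mem_vclass Av andbT; apply/eqP.
have [R RH [_ sR]] := edge_within iW sW; have [+ _] := cP.2 R RH; apply.
have Ra v : v \in R -> c v = a.
  move=> /(subsetP sR); rewrite !inE => /orP[/eqP|/andP[_ /eqP//]].
  by case: v => j [] /= ->.
by move=> u v Ru Rv; rewrite (Ra u Ru) (Ra v Rv).
Qed.

Lemma transversal (A : {set 'I_k}) :
  exists W, [/\ {in W &, injective c}, forall v, v \in W -> c v \in A
              & #|W| = #|A|].
Proof.
have /fin_all_exists[g gK] := cP.1.
exists (g @: A); split.
- by move=> _ _ /imsetP[a _ ->] /imsetP[b _ ->]; rewrite !gK => ->.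
- by move=> _ /imsetP[a Aa ->]; rewrite gK.
- by apply: card_imset; apply: can_inj gK.
Qed.

Lemma card_setC2 (a b : 'I_k) : k <= #|~: [set a; b]| + 2.
Proof.
by have := cardsC [set a; b]; rewrite card_ord cards2; case: (a != b); lia.
Qed.

Lemma monochromatic_classes i : 2 * s < k -> c (i, false) = c (i, true).
Proof.
move=> ltk; apply/eqP/negPn/negP=> ci.
have [W [injW WA cardW]] := transversal (~: [set c (i, false); c (i, true)]).
have := few_classes ci injW; have := card_le_classes W.
have := card_setC2 (c (i, false)) (c (i, true)); rewrite -cardW => h1 h2 h3.
suff: #|[set v.1 | v in W]| < s by lia.
by apply: h3 => v /WA; rewrite !inE negb_or.
Qed.

Lemma colours_le_classes : 2 * s < k -> k <= n.
Proof.
move=> ltk; pose h i := c (i, false).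
have -> : k = #|h @: [set: 'I_n]|.
  rewrite -[LHS]card_ord -cardsT; apply: eq_card => a; rewrite inE.
  have [[i b] <-] := cP.1 a; symmetry; apply/imsetP; exists i => //.
  by case: b; rewrite /h // monochromatic_classes.
by apply: leq_trans (leq_imset_card _ _) _; rewrite cardsT card_ord.
Qed.

Definition mate v : 'I_n * bool := (v.1, ~~ v.2).

Lemma mate_eq u v : u.1 = v.1 -> u != v -> v = mate u.
Proof.
by case: u v => [i b] [j d] /= <-; rewrite /mate /= xpair_eqE eqxx; case: b d => [] [].
Qed.

Lemma few_classes_mate u W :
    c u != c (mate u) -> {in W &, injective c} ->
    (forall v, v \in W -> (c v != c u) && (c v != c (mate u))) ->
  #|[set v.1 | v in W]| < s.
Proof.
case: u => i []; rewrite /mate /= => cu injW Wu.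
  by apply: (@few_classes i) => // [|v /Wu]; rewrite 1?eq_sym // andbC.
exact: (@few_classes i).
Qed.

Lemma no_parallel_classes (u v : 'I_n * bool) :
    2 < s -> 2 * s - 1 <= k -> u.1 != v.1 -> c u != c (mate u) ->
  c u = c v -> c (mate u) = c (mate v) -> False.
Proof.
move=> s_gt2 lek uv cu cuv cmuv.
have [W [injW WA cardW]] := transversal (~: [set c u; c (mate u)]).
have {}WA x : x \in W -> (c x != c u) && (c x != c (mate u)).
  by move=> /WA; rewrite !inE negb_or.
have ltW := few_classes_mate cu injW WA.
have lekW := card_setC2 (c u) (c (mate u)); rewrite -cardW in lekW.
have W1 x y : x \in W -> c y = c u -> c (mate y) = c (mate u) -> x.1 != y.1.
  move=> Wx yu ymu; apply/eqP=> xy; have := WA x Wx.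
  have [<-|nyx] := eqVneq y x; first by rewrite yu eqxx.
  by rewrite (mate_eq (esym xy) nyx) ymu eqxx andbF.
(* If no two vertices of [W] shared a class, [W] would meet at least [k - 2 >= 2 * s - 3 >= s]
   classes, as [s >= 3]. *)
have [x Wx [y]] : exists2 x, x \in W &
    exists2 y, y \in [predD1 W & x] & x.1 = y.1.
  apply/dinjectivePn/negP=> /dinjectiveP injW1.
  by move: ltW; rewrite (card_in_imset injW1); lia.
rewrite !inE => /andP[nyx Wy] xy.
have yE : y = mate x by apply: mate_eq; rewrite // eq_sym.
have cxy : c x != c (mate x).
  by apply: contra nyx => /eqP cE; apply/eqP/injW => //; rewrite cE yE.
(* The class {x, y} lies inside W, so it can serve as the full class of an edge
   completed by u, by mate v and by the rest of W. *)
pose W3 := W :\ x :\ y; pose W2 := u |: (mate v |: W3).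
have W3W z : z \in W3 -> [/\ z \in W, z != x & z != y].
  by rewrite !inE => /and3P[].
have W3c z w : z \in W3 -> w \in W -> z != w -> c z != c w.
  by move=> /W3W[Wz _ _] Ww; apply: contra => /eqP cE; apply/eqP/injW.
have W2P z : z \in W2 -> [\/ z = u, z = mate v | z \in W3].
  rewrite !in_setU1 => /or3P[/eqP|/eqP|]; first by constructor 1.
    by constructor 2.
  by constructor 3.
have injW2 : {in W2 &, injective c}.
  have W3u z : z \in W3 -> (c z != c u) && (c z != c (mate u)).
    by move=> /W3W[/WA].
  have Wcu z : z \in W3 -> c z = c u -> False.
    by move=> /W3u /andP[/eqP].
  have Wcm z : z \in W3 -> c z = c (mate v) -> False.
    by move=> /W3u /andP[_ /eqP]; rewrite cmuv.
  have cuv' : c u = c (mate v) -> False by move: cu; rewrite cmuv => /eqP.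
  move=> z w /W2P[-> | -> | Wz] /W2P[-> | -> | Ww] // cE.
  - by case: (Wcu w Ww (esym cE)).
  - by case: (cuv' (esym cE)).
  - by case: (Wcm w Ww (esym cE)).
  - by case: (Wcu z Wz cE).
  - by case: (Wcm z Wz cE).
  - by have [? _ _] := W3W z Wz; have [? _ _] := W3W w Ww; apply: injW.
have W2x z : z \in W2 -> (c z != c x) && (c z != c (mate x)).
  rewrite -yE; have /andP[xu xmu] := WA x Wx; have /andP[yu ymu] := WA y Wy.
  case/W2P=> [->|->|Wz].
  - by rewrite !(eq_sym (c u)) xu yu.
  - by rewrite -cmuv !(eq_sym (c (mate u))) xmu ymu.
  - by have [_ zx zy] := W3W z Wz; rewrite !W3c.
have := few_classes_mate cxy injW2 W2x; rewrite ltnNge => /negP; apply.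
have -> : [set w.1 | w in W2] = u.1 |: (v.1 |: [set w.1 | w in W3]).
  by rewrite !imsetU1.
have vW3 : v.1 \notin [set w.1 | w in W3].
  apply/imsetP=> -[z /W3W[Wz _ _]] vz.
  by have := W1 z v Wz (esym cuv) (esym cmuv); rewrite vz eqxx.
have uW3 : u.1 \notin v.1 |: [set w.1 | w in W3].
  rewrite in_setU1 negb_or uv; apply/imsetP=> -[z /W3W[Wz _ _]] uz.
  by have := W1 z u Wz erefl erefl; rewrite uz eqxx.
(* The 4 accounts for the two colours [W] avoids and for [x] and [y]. As [k >= 2 * s - 1], [W3]
   meets at least [s - 2] classes; those of [u] and [v] make [s]. *)
have lek4 : k <= 2 * #|[set w.1 | w in W3]| + 4.
  apply: leq_trans lekW _.
  rewrite (cardsD1 x) (cardsD1 y (W :\ x)) !inE nyx Wx Wy /= -/W3.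
  by rewrite !addnS !addn0 !addSn !ltnS card_le_classes.
by rewrite !cardsU1 uW3 vW3 /=; move: #|[set w.1 | w in W3]| lek4 => m; lia.
Qed.

(** Averaging: [2 * n > 2 * s * k] vertices share [k] colours. *)
Lemma crowded_colour : s * k < n -> exists a, 2 * s < #|[set v | c v == a]|.
Proof.
move=> ltn; apply/existsP; apply: contraLR ltn => /existsPn le2s; rewrite -leqNgt.
have : #|{: 'I_n * bool}| <= \sum_(a < k) 2 * s.
  rewrite -sum1_card (partition_big c predT) //=; apply: leq_sum => a _.
  by rewrite sum1dep_card leqNgt le2s.
by rewrite card_prod card_ord card_bool sum_nat_const card_ord; nia.
Qed.

Lemma classes_le_colours : 2 < s -> 2 * s - 1 <= k -> n <= s * k.
Proof.
move=> s_gt2 lek; rewrite leqNgt; apply/negP=> /crowded_colour[a].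
set A := [set v | c v == a] => sA.
have Am v : v \in A -> c v = a /\ c (mate v) != a.
  rewrite inE => /eqP va; split=> //; move: sA; rewrite ltnNge; apply: contra.
  case: v va => i [] va /eqP mva; exact: (@few_vertices_mono i).
have [ltk|gek] := ltnP (2 * s) k.
  have /card_gt0P[v /Am[va]] : 0 < #|A| by lia.
  rewrite -{1}va; have := monochromatic_classes v.1 ltk.
  by case: v va => i [] _ /= e /eqP[]; rewrite /mate /= e.
(* The mates of the more than [2 * s] vertices of [A] avoid [a], so they take at most
   [k - 1 < 2 * s] colours. *)
have [u Au [v]] : exists2 u, u \in A &
    exists2 v, v \in [predD1 A & u] & c (mate u) = c (mate v).
  apply/dinjectivePn/negP=> /dinjectiveP injA.
  suff : 2 * s < k.-1 by lia.
  apply: leq_trans sA _; rewrite -(card_in_imset injA).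
  have <- : #|[set~ a]| = k.-1 by rewrite cardsC1 card_ord.
  apply/subset_leq_card/subsetP=> _ /imsetP[v /Am[_ va] ->].
  by rewrite !inE.
rewrite in_simpl /= => /andP[nvu Av] muv.
have [[ua mua] [va mva]] := (Am u Au, Am v Av).
apply: (@no_parallel_classes u v) => //; rewrite ?ua ?va 1?eq_sym //.
apply/eqP=> uv; have vE : v = mate u by apply: mate_eq; rewrite // eq_sym.
by move: mua; rewrite -vE va eqxx.
Qed.

End NoColouring.

(** * Explicit colourings *)

Lemma colourable_modn n s k : 0 < k -> k <= n -> n <= s * k ->
  NMNR_colourable (calH n s.+2) k.
Proof.
move=> k_gt0 lekn lens.
exists (fun v : 'I_n * bool => Ordinal (ltn_pmod v.1 k_gt0)).
split=> [a|e /edge_class[i ie sz]].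
  have ltan : a < n by apply: leq_trans (ltn_ord a) lekn.
  by exists (Ordinal ltan, true); apply: val_inj; rewrite /= modn_small.
split=> [mono|rain]; last first.
  suff : (i, false) = (i, true) by [].
  by apply: rain; [apply: (subsetP ie).. |]; rewrite ?inE //=; apply: val_inj.
have s_gt0 : 0 < s by case: s lens {sz} => //; lia.
(* Classes of equal residue mod [k] are told apart by their quotients, which take at most [s]
   values, while an edge meets more than [s] classes. *)
have ltq (j : 'I_n) : j %/ k < s.
  by rewrite ltn_divLR //; apply: leq_trans lens.
pose q (j : 'I_n) := Ordinal (ltq j).
move: sz; rewrite ltnNge => /negP; apply.
rewrite -[X in _ <= X]card_ord -(@card_in_imset _ _ q); first exact: max_card.
move=> _ _ /imsetP[v ve ->] /imsetP[w we ->] /(congr1 val) /= qE.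
have /(congr1 val) /= mE := mono v w ve we.
by apply: val_inj; rewrite /= (divn_eq v.1 k) qE mE -divn_eq.
Qed.

Lemma colourable_few n s k : 1 < k -> k <= 2 * s - 2 -> k <= n ->
  NMNR_colourable (calH n s.+2) k.
Proof.
move=> k_gt1 leks lekn.
(* Colours 2, 3, 4, ... are spent in pairs on the first classes; every class from
   there on is coloured {0, 1}. *)
pose f (v : 'I_n * bool) := 2 * v.1 + 2 + v.2.
pose g (v : 'I_n * bool) := if f v < k then f v else v.2 : nat.
have gk v : g v < k by rewrite /g; case: ifP => //; case: (v.2); lia.
exists (fun v => Ordinal (gk v)); split=> [a|e /edge_class[i ie sz]].
  (* The last class supplies colours 0 and 1: there [f] is at least [2 * n >= k]. *)
  have n_gt0 : n.-1 < n by lia.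
  have [lta2|le2a] := ltnP a 2.
    exists (Ordinal n_gt0, val a == 1); apply: val_inj; rewrite /g /f /=.
    by case: ltnP; case: a lta2 => -[|[]] //= *; lia.
  have lti : (a - 2)./2 < n by have := ltn_ord a; lia.
  exists (Ordinal lti, odd a); apply: val_inj; rewrite /g /f /=.
  have -> : 2 * (a - 2)./2 + 2 + odd a = a by lia.
  by rewrite ltn_ord.
split=> [mono|rain].
  (* For odd [k] one class gets the colours [k - 1] and 1, which differ since [k >= 3]. *)
  have : g (i, false) = g (i, true).
    by apply: (congr1 val (mono _ _ _ _)); apply: (subsetP ie); rewrite inE.
  by rewrite /g /f /=; do !case: ifP => ?; lia.
(* A rainbow [e] has at most two vertices in classes coloured {0, 1}, and at most [s - 2] classes
   are coloured otherwise; so [e] would meet at most [s] classes. *)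
pose B := [set v in e | k <= 2 * v.1 + 2].
have B2 : #|B| <= 2.
  have B1 v : v \in B -> v \in e /\ g v < 2.
    rewrite inE /g /f => /andP[ve kv]; split=> //.
    by case: ifPn => [|_]; [rewrite ltnNge (leq_trans kv) ?leq_addr | case: (v.2)].
  rewrite -card_bool -(@card_in_imset _ _ (fun v => g v == 0)) ?max_card //.
  move=> v w /B1[ve gv] /B1[we gw] gvw; apply: rain => //; apply: val_inj => /=.
  by move: gvw; case: (g v) gv => [|[]] //; case: (g w) gw => [|[]].
pose D := [set j : 'I_n | 2 * j + 2 < k].
have D2 : #|D| <= s - 2.
  rewrite cardE -(size_map val) -[X in _ <= X](size_iota 0).
  apply: uniq_leq_size; first by rewrite map_inj_uniq ?enum_uniq //; apply: val_inj.
  by move=> _ /mapP[j + ->]; rewrite mem_enum inE mem_iota /= => jk; lia.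
have : #|[set v.1 | v in e]| <= #|D :|: [set v.1 | v in B]|.
  apply/subset_leq_card/subsetP=> _ /imsetP[v ve ->]; rewrite in_setU in_set.
  by case: ltnP => //= kv; apply/imsetP; exists v; rewrite // inE ve.
have := leq_imset_card (fun v : 'I_n * bool => v.1) B.
have := cardsU D [set v.1 | v in B].
move: #|_ :|: _| #|[set v.1 | v in B]| #|B| #|[set v.1 | v in e]| #|D| B2 D2 sz.
move=> *; lia.
Qed.

Lemma ceil_ratio_le (n s k : nat) : 0 < s ->
  (Num.ceil (n%:Q / s%:Q) <= k%:Z)%R = (n <= s * k).
Proof.
move=> s_gt0; rewrite ceil_le_int.
rewrite ler_pdivrMr ?ltr0z //.
by rewrite -intrM ler_int lez_nat mulnC.
Qed.

Theorem theorem3p3 (r n : nat) (hr : 6 <= r)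
    (hn : 2 * (r - 2) * (r - 1) + 1 <= n) (k : nat) (hk : 0 < k) :
  [/\ (n < k -> ~ NMNR_colourable (calH n r) k),
      ((Num.ceil (n%:Q / (r - 2)%N%:Q) <= k%:Z)%R -> k <= n ->
         NMNR_colourable (calH n r) k),
      (2 * r - 5 <= k -> (k%:Z < Num.ceil (n%:Q / (r - 2)%N%:Q))%R ->
         ~ NMNR_colourable (calH n r) k)
    & (2 <= k -> k <= 2 * r - 6 -> NMNR_colourable (calH n r) k)].
Proof.
case: r hr hn => [|[|s]] // hs; rewrite !subn2 /= => hn.
have s_gt0 : 0 < s by lia.
split.
(* Here [hn] reads [2 * s * (s + 1) + 1 <= n], so [n] already exceeds [2 * s]. *)
- move=> ltnk [c cP]; have : 2 * s < k by nia.
  by move/(colours_le_classes cP); lia.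
- by rewrite ceil_ratio_le // => lens lekn; apply: colourable_modn.
- rewrite ltNge ceil_ratio_le // => lek /negP ltn [c cP].
  by apply/ltn/(classes_le_colours cP); lia.
- by move=> gek lek; apply: colourable_few; [| lia | nia].
Qed.
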